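(* Fix $\nu\in(0,1)$, an integer $k\ge2$ and $\pi\in\Lambda$. Assume that the noise random variables $\xi_1,\ldots,\xi_n$ are independent and sub-Gaussian with variance proxy $\sigma^2>0$. Take $\rho\equiv1$ and $$\beta\ge 2\sigma^2\inf_{\theta}\max\left\{\frac{1}{\nu-\frac{4(1-\nu)(1-\theta)}{(k+3)\theta}};\ \frac{1}{(1-\theta)(1-\nu)\left(1-\frac{4}{k+3}\right)}\right\},$$ where the infimum is over those $\theta\in(0,1]$ for which $\nu-\frac{4(1-\nu)(1-\theta)}{(k+3)\theta}>0$ (and $1/0=+\infty$). Then for any $\delta\in(0,1)$ the aggregate estimator $\mathsf{f}_{\lambda^{(k)}}$, where $\lambda^{(k)}$ is output by GMA-0 (or GMA-0$_+$) after $k$ steps, satisfies $$\operatorname{MSE}(\mathsf{f}_{\lambda^{(k)}})\le\min_{1\le j\le M}\Big\{\operatorname{MSE}(f_j)+\frac{\beta}{n}\log\Big(\frac{1}{\pi_j\delta}\Big)\Big\}$$ with probability $1-\delta$ (i.e. at least $1-\delta$). Moreover, $$\mathbb{E}\operatorname{MSE}(\mathsf{f}_{\lambda^{(k)}})\le\min_{1\le j\le M}\Big\{\operatorname{MSE}(f_j)+\frac{\beta}{n}\log\Big(\frac{1}{\pi_j}\Big)\Big\}.$$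
   Context: Fixed design regression: $x_1,\ldots,x_n$ are given points of a set $\mathcal{X}$, $f_1,\ldots,f_M:\mathcal{X}\to\mathbb{R}$ are given functions (the dictionary), $\eta:\mathcal{X}\to\mathbb{R}$ is an unknown function, and one observes $Y_i=\eta(x_i)+\xi_i$, $i=1,\ldots,n$. The random vector $\xi=(\xi_1,\ldots,\xi_n)^\top$ is sub-Gaussian with variance proxy $\sigma^2$ if $\mathbb{E}[e^{t^\top\xi}]\le e^{\sigma^2|t|_2^2/2}$ for all $t\in\mathbb{R}^n$ ($|\cdot|_2$ is the Euclidean norm). For $f:\mathcal{X}\to\mathbb{R}$: $\operatorname{MSE}(f)=\frac1n\sum_{i=1}^n(\eta(x_i)-f(x_i))^2$ and $\widehat{\operatorname{MSE}}(f)=\frac1n\sum_{i=1}^n(Y_i-f(x_i))^2$. $\Lambda=\{\lambda\in\mathbb{R}^M:\lambda_j\ge0,\ \sum_{j=1}^M\lambda_j=1\}$ and $\mathsf{f}_\lambda=\sum_{j=1}^M\lambda_jf_j$. With $\rho\equiv1$ the objective is $$Q(\lambda)=(1-\nu)\widehat{\operatorname{MSE}}(\mathsf{f}_\lambda)+\nu\sum_{j=1}^M\lambda_j\widehat{\operatorname{MSE}}(f_j)+\frac{\beta}{n}\sum_{j=1}^M\lambda_j\log\frac1{\pi_j},$$ where terms of the last sum with $\lambda_j=0$ are $0$ and $\log(1/0)=+\infty$. Algorithms GMA-0 and GMA-0$_+$ (greedy model averaging). Let $\mathsf{e}^{(j)}$ be the $j$th canonical basis vector of $\mathbb{R}^M$.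 Start from $\lambda^{(0)}=0\in\mathbb{R}^M$. For $k=1,2,\ldots$: set $\alpha_k=\frac{2}{k+1}$; choose $J^{(k)}\in\operatorname{argmin}_{1\le j\le M}Q\big(\lambda^{(k-1)}+\alpha_k(\mathsf{e}^{(j)}-\lambda^{(k-1)})\big)$; then - GMA-0: $\lambda^{(k)}=\lambda^{(k-1)}+\alpha_k(\mathsf{e}^{(J^{(k)})}-\lambda^{(k-1)})$; - GMA-0$_+$: $\lambda^{(k)}\in\operatorname{argmin}\{Q(\lambda):\lambda\in\Lambda,\ \lambda_j=0\text{ for }j\notin\{J^{(1)},\ldots,J^{(k)}\}\}$. Choices among minimizers are arbitrary (measurable functions of the data). *)

(* Defs.v *)
From HB Require Import structures.
From mathcomp Require Import all_boot all_order all_algebra.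
From mathcomp Require Import all_classical all_reals all_analysis.
Set Implicit Arguments.
Unset Strict Implicit.
Unset Printing Implicit Defensive.
Import Order.TTheory GRing.Theory Num.Theory.
Import numFieldNormedType.Exports.
Local Open Scope classical_set_scope.
Local Open Scope ring_scope.

(** * Probability *)

(* The Euclidean norm is spelled out: the library norm on row vectors is the
   sup norm. *)
Definition sub_gaussian (d : measure_display) (T : measurableType d)
    (R : realType) (P : probability T R) (m : nat) (Z : 'I_m -> T -> R)
    (proxy : R) : Prop :=
  forall t : 'rV[R]_m,
    ('E_P[fun w => expR (\sum_(i < m) t 0 i * Z i w)] <=
     (expR (proxy * (\sum_(i < m) t 0 i ^+ 2) / 2))%:E)%E.

Definition independent_RVs (d : measure_display) (T : measurableType d)
    (R : realType) (P : probability T R) (m : nat) (Z : 'I_m -> {RV P >-> R})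
    : Prop :=
  forall (I : {set 'I_m}) (A : 'I_m -> set R),
    (forall i, measurable (A i)) ->
    P (\bigcap_(i in [set` I]) (Z i @^-1` A i)) =
    (\prod_(i in I) P (Z i @^-1` A i))%E.

(** * Regression *)

Definition responses (R : realType) (X : Type) (n : nat) (x : 'I_n -> X)
    (eta : X -> R) (noise : 'I_n -> R) : n.-tuple R :=
  [tuple eta (x i) + noise i | i < n].

Definition MSE (R : realType) (X : Type) (n : nat) (x : 'I_n -> X)
    (eta g : X -> R) : R :=
  n%:R^-1 * \sum_(i < n) (eta (x i) - g (x i)) ^+ 2.

Definition empirical_MSE (R : realType) (X : Type) (n : nat) (x : 'I_n -> X)
    (y : n.-tuple R) (g : X -> R) : R :=
  n%:R^-1 * \sum_(i < n) (tnth y i - g (x i)) ^+ 2.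

Definition simplex (R : realType) (M : nat) : set 'rV[R]_M :=
  [set lam | (forall j, 0 <= lam 0 j) /\ \sum_(j < M) lam 0 j = 1].
Arguments simplex : clear implicits.

Definition aggregate (R : realType) (X : Type) (M : nat) (f : 'I_M -> X -> R)
    (lam : 'rV[R]_M) : X -> R :=
  fun u => \sum_(j < M) lam 0 j * f j u.

(* log (1 / u) for u >= 0, with log (1 / 0) = +oo: in \bar R, 0^-1 = +oo and
   lne +oo = +oo. *)
Definition log_inv (R : realType) (u : R) : \bar R := lne (u%:E^-1)%E.

(* The convention 0 * log (1 / 0) = 0 is that of \bar R, where 0 * +oo = 0. *)
Definition objective (R : realType) (X : Type) (n M : nat) (x : 'I_n -> X)
    (f : 'I_M -> X -> R) (nu beta : R) (prior : 'rV[R]_M) (y : n.-tuple R)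
    (lam : 'rV[R]_M) : \bar R :=
  (((1 - nu) * empirical_MSE x y (aggregate f lam))%:E
   + (nu * \sum_(j < M) lam 0 j * empirical_MSE x y (f j))%:E
   + (beta / n%:R)%:E * \sum_(j < M) (lam 0 j)%:E * log_inv (prior 0 j)%R)%E.

(** * Greedy model averaging *)

Definition argmin (R : realType) (T : Type) (A : set T) (g : T -> \bar R)
    : set T :=
  [set t | A t /\ forall u, A u -> (g t <= g u)%E].

Definition greedy_move (R : realType) (M : nat) (s : nat) (lam : 'rV[R]_M)
    (j : 'I_M) : 'rV[R]_M :=
  lam + (2 / s.+1%:R) *: (delta_mx 0 j - lam).

(* [J] and [lam] are the successive choices and iterates of the first [k] steps
   of an execution of the algorithm minimizing [Q]; the values [J 0], [J s] and
   [lam s] for [s > k] are irrelevant. *)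
Definition GMA0 (R : realType) (M : nat) (Q : 'rV[R]_M -> \bar R) (k : nat)
    (J : nat -> 'I_M) (lam : nat -> 'rV[R]_M) : Prop :=
  lam 0%N = 0 /\
  forall s, (1 <= s <= k)%N ->
    argmin [set: 'I_M] (fun j => Q (greedy_move s (lam s.-1) j)) (J s) /\
    lam s = greedy_move s (lam s.-1) (J s).

Definition GMA0plus (R : realType) (M : nat) (Q : 'rV[R]_M -> \bar R) (k : nat)
    (J : nat -> 'I_M) (lam : nat -> 'rV[R]_M) : Prop :=
  lam 0%N = 0 /\
  forall s, (1 <= s <= k)%N ->
    argmin [set: 'I_M] (fun j => Q (greedy_move s (lam s.-1) j)) (J s) /\
    argmin (simplex R M `&`
            [set mu | forall j, (forall r, (1 <= r <= s)%N -> j <> J r) ->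
                                mu 0 j = 0])
           Q (lam s).

Definition measurable_choices (R : realType) (n M k : nat)
    (J : nat -> n.-tuple R -> 'I_M) (lam : nat -> n.-tuple R -> 'rV[R]_M)
    : Prop :=
  forall s, (1 <= s <= k)%N -> forall j : 'I_M,
    measurable [set y | J s y = j] /\
    measurable_fun [set: n.-tuple R] (fun y => lam s y 0 j).

(** * The lower bound on the temperature *)

Definition theta_gap (R : realType) (nu : R) (k : nat) (theta : R) : R :=
  nu - 4 * (1 - nu) * (1 - theta) / ((k + 3)%:R * theta).

(* Inverses are taken in \bar R, where 0^-1 = +oo (case theta = 1). *)
Definition beta_factor (R : realType) (nu : R) (k : nat) : \bar R :=
  ereal_inf
    [set Order.max ((theta_gap nu k theta)%:E^-1)%E
           (((1 - theta) * (1 - nu) * (1 - 4 / (k + 3)%:R))%:E^-1)%E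
    | theta in [set theta | 0 < theta <= 1 /\ 0 < theta_gap nu k theta]].

(* Main.v *)
Require Import Defs.
From mathcomp Require Import all_boot all_order all_algebra.
From mathcomp Require Import all_classical all_reals all_analysis.
From mathcomp Require Import measurable_realfun ring lra.
Set Implicit Arguments.
Unset Strict Implicit.
Unset Printing Implicit Defensive.
Import Order.TTheory GRing.Theory Num.Theory.
Import numFieldNormedType.Exports.
Import HBNNSimple.
Local Open Scope classical_set_scope.
Local Open Scope ring_scope.

(** Write F_j for the vector (f_j(x_1), ..., f_j(x_n)), |.|^2 for the normalized
    square distance [sqdist], F_lam for the mixture of the F_j with weights lam,
    and V(lam) for the variance [spread] of the F_j under lam.

    The criterion Q is a quadratic function of lam whose curvature along a
    segment from mu to w is (1 - nu) |F_mu - F_w|^2 ([penalized_segment]).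
    Hence Q(mu + alpha (e_j - mu)), averaged over j with weights w, exceeds
    Q(mu + alpha (w - mu)) by (1 - nu) alpha^2 V(w) only, and the best greedy
    move does at least as well as this average ([wavg_penalized_step]).  With steps
    2 / (s + 1), induction gives
    Q(lam_k) <= Q(w) + 4 (1 - nu) V(w) / (k + 3) for every w in the simplex that
    vanishes where the prior does ([greedy_rate]).  Both algorithms are covered,
    since they enter only through the fact that lam_s does at least as well as
    every greedy move ([greedy_descent]).

    Applying this to the point w at proportion theta from lam_k to e_j, and
    using the curvature of Q a second time, gives an inequality between Q(lam_k)
    and Q(e_j) with the two gains theta_gap * V(lam_k) and
    (1 - theta)(1 - nu)(1 - 4 / (k + 3)) |F_lam_k - F_j|^2 ([chord_oracle]).
    The lower bound on beta says that both coefficients can be brought at least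
    arbitrarily close to 2 sigma^2 / beta by the choice of theta; as the
    inequality is deterministic and holds for every theta, passing to the limit
    costs nothing ([beta_factor_bound]).  By the bias-variance identity [huygens]
    the two square distances add up to sum_i lam_i |F_i - F_j|^2.

    It remains to control the noise term (2 / n) <xi, F_lam_k - F_j>, where
    lam_k depends on xi.  It is a lam-average of terms attached to the vertices,
    so the convexity of exp ([donsker_varadhan]) replaces the random weights by
    the prior and bounds everything by log W_j, W_j being the prior average of
    exp (2 / beta <xi, F_i - F_j> - 2 sigma^2 n / beta^2 |F_i - F_j|^2)
    ([greedy_exp_bound]).  Independence makes the vector xi sub-Gaussian
    ([independent_sub_gaussian]), hence E W_j <= 1.  Markov's inequality for W_j
    gives the deviation bound and log W <= W - 1 the bound in expectation.  The
    minimum over j is a minimum of constants, so that one j suffices for the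
    deviation bound. *)

(** * Mixtures and the quadratic criterion *)

Definition wavg (R : realType) (M : nat) (lam : 'rV[R]_M) (a : 'I_M -> R) : R :=
  \sum_(j < M) lam 0 j * a j.

Definition mix (R : realType) (n M : nat) (F : 'I_M -> 'I_n -> R)
    (lam : 'rV[R]_M) : 'I_n -> R :=
  fun i => wavg lam (F ^~ i).

Definition sqdist (R : realType) (n : nat) (u v : 'I_n -> R) : R :=
  n%:R^-1 * \sum_(i < n) (u i - v i) ^+ 2.

Definition spread (R : realType) (n M : nat) (F : 'I_M -> 'I_n -> R)
    (lam : 'rV[R]_M) : R :=
  wavg lam (fun j => sqdist (mix F lam) (F j)).

Definition segment (R : realType) (M : nat) (alpha : R) (mu w : 'rV[R]_M) :
    'rV[R]_M := mu + alpha *: (w - mu).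

(** The objective with finite costs [c]: a real-valued form on which the algebra
    takes place, equal to the objective at points that put no weight where the
    prior vanishes ([objective_dominated]). *)
Definition penalized (R : realType) (n M : nat) (F : 'I_M -> 'I_n -> R) (nu : R)
    (c : 'I_M -> R) (y : 'I_n -> R) (lam : 'rV[R]_M) : R :=
  (1 - nu) * sqdist y (mix F lam)
  + nu * wavg lam (fun j => sqdist y (F j)) + wavg lam c.

Lemma wavg_segment (R : realType) (M : nat) (alpha : R) (mu w : 'rV[R]_M)
    (a : 'I_M -> R) :
  wavg (segment alpha mu w) a = (1 - alpha) * wavg mu a + alpha * wavg w a.
Proof.
rewrite /wavg !mulr_sumr -big_split /=; apply: eq_bigr => j _.
by rewrite !mxE; ring.
Qed.

Lemma wavg_delta (R : realType) (M : nat) (j : 'I_M) (a : 'I_M -> R) :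
  wavg (delta_mx 0 j) a = a j.
Proof.
rewrite /wavg (bigD1 j)//= big1 ?addr0 ?mxE ?eqxx ?mul1r// => i ij.
by rewrite mxE (negbTE ij) andbF mul0r.
Qed.

Lemma wavgD (R : realType) (M : nat) (lam : 'rV[R]_M) (a b : 'I_M -> R) :
  wavg lam (fun j => a j + b j) = wavg lam a + wavg lam b.
Proof. by rewrite /wavg -big_split; apply: eq_bigr => j _; rewrite mulrDr. Qed.

Lemma wavgZ (R : realType) (M : nat) (lam : 'rV[R]_M) (r : R) (a : 'I_M -> R) :
  wavg lam (fun j => r * a j) = r * wavg lam a.
Proof. by rewrite /wavg mulr_sumr; apply: eq_bigr => j _; rewrite mulrCA. Qed.

Lemma wavg_cst (R : realType) (M : nat) (lam : 'rV[R]_M) (r : R) :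
  simplex R M lam -> wavg lam (fun=> r) = r.
Proof. by case=> _ lam1; rewrite /wavg -mulr_suml lam1 mul1r. Qed.

Lemma ler_wavg (R : realType) (M : nat) (lam : 'rV[R]_M) (a b : 'I_M -> R) :
  simplex R M lam -> (forall j, lam 0 j != 0 -> a j <= b j) ->
  wavg lam a <= wavg lam b.
Proof.
move=> [lam0 _] ab; apply: ler_sum => j _.
have [->|lamj] := eqVneq (lam 0 j) 0; first by rewrite !mul0r.
by rewrite ler_wpM2l// ab.
Qed.

Lemma mix_segment (R : realType) (n M : nat) (F : 'I_M -> 'I_n -> R) (alpha : R)
    (mu w : 'rV[R]_M) (i : 'I_n) :
  mix F (segment alpha mu w) i = (1 - alpha) * mix F mu i + alpha * mix F w i.
Proof. exact: wavg_segment. Qed.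

Lemma mix_delta (R : realType) (n M : nat) (F : 'I_M -> 'I_n -> R) (j : 'I_M) :
  mix F (delta_mx 0 j) = F j.
Proof. by apply/funext => i; rewrite /mix wavg_delta. Qed.

Lemma sqdist_ge0 (R : realType) (n : nat) (u v : 'I_n -> R) : 0 <= sqdist u v.
Proof. by rewrite mulr_ge0// ?sumr_ge0// => i _; exact: sqr_ge0. Qed.

Lemma sqdistxx (R : realType) (n : nat) (u : 'I_n -> R) : sqdist u u = 0.
Proof. by rewrite /sqdist big1 ?mulr0// => i _; rewrite subrr expr0n. Qed.

Lemma sqdist_segment (R : realType) (n M : nat) (F : 'I_M -> 'I_n -> R)
    (alpha : R) (mu w : 'rV[R]_M) (y : 'I_n -> R) :
  sqdist y (mix F (segment alpha mu w)) =
  (1 - alpha) * sqdist y (mix F mu) + alpha * sqdist y (mix F w)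
  - alpha * (1 - alpha) * sqdist (mix F mu) (mix F w).
Proof.
rewrite /sqdist !(mulrCA _ n%:R^-1) -mulrDr -mulrBr; congr (_ * _).
rewrite !mulr_sumr -big_split -sumrB /=; apply: eq_bigr => i _.
by rewrite mix_segment; ring.
Qed.

(** Bias-variance identity: the mean square distance from [u] to a random vertex
    splits at the mean.  Taking various [u] is the way in which spreads are
    computed here. *)
Lemma huygens (R : realType) (n M : nat) (F : 'I_M -> 'I_n -> R)
    (lam : 'rV[R]_M) (u : 'I_n -> R) : simplex R M lam ->
  wavg lam (fun j => sqdist u (F j)) = sqdist u (mix F lam) + spread F lam.
Proof.
move=> lamS.
have e v : wavg lam (fun j => sqdist v (F j)) = n%:R^-1 *
    \sum_(i < n) (v i ^+ 2 - 2 * v i * mix F lam i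
                  + wavg lam (fun j => F j i ^+ 2)).
  rewrite wavgZ; congr (_ * _).
  rewrite /wavg; under eq_bigr do rewrite mulr_sumr.
  rewrite exchange_big /=; apply: eq_bigr => i _.
  rewrite -[v i ^+ 2](wavg_cst _ lamS) /mix -wavgZ -sumrB -big_split /=.
  by apply: eq_bigr => j _; ring.
rewrite /spread !e /sqdist -mulrDr -big_split; congr (_ * _).
by apply: eq_bigr => i _ /=; ring.
Qed.

Lemma spread_ge0 (R : realType) (n M : nat) (F : 'I_M -> 'I_n -> R)
    (lam : 'rV[R]_M) : simplex R M lam -> 0 <= spread F lam.
Proof.
by move=> [lam0 _]; apply: sumr_ge0 => j _; rewrite mulr_ge0 ?sqdist_ge0.
Qed.

Lemma spread_delta (R : realType) (n M : nat) (F : 'I_M -> 'I_n -> R)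
    (j : 'I_M) : spread F (delta_mx 0 j) = 0.
Proof. by rewrite /spread wavg_delta mix_delta sqdistxx. Qed.

Lemma simplex_delta (R : realType) (M : nat) (j : 'I_M) :
  simplex R M (delta_mx 0 j).
Proof.
split=> [i|]; first by rewrite mxE ler0n.
rewrite -(wavg_delta j (fun=> 1)); apply: eq_bigr => i _; by rewrite mulr1.
Qed.

Lemma simplex_segment (R : realType) (M : nat) (alpha : R) (mu w : 'rV[R]_M) :
  0 <= alpha <= 1 -> simplex R M mu -> simplex R M w ->
  simplex R M (segment alpha mu w).
Proof.
move=> a01 [mu0 mu1] [w0 w1]; split=> [j|].
  have := mu0 j; have := w0 j; rewrite !mxE => ? ?.
  rewrite (_ : _ + _ = (1 - alpha) * mu 0 j + alpha * w 0 j); last by ring.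
  by rewrite addr_ge0// mulr_ge0//; lra.
under eq_bigr do rewrite !mxE.
by rewrite big_split -mulr_sumr sumrB /= mu1 w1; ring.
Qed.

(** Law of total variance: apply [huygens] at [u := mix F mu] on both sides. *)
Lemma spread_segment (R : realType) (n M : nat) (F : 'I_M -> 'I_n -> R)
    (theta : R) (mu w : 'rV[R]_M) :
  0 <= theta <= 1 -> simplex R M mu -> simplex R M w ->
  spread F (segment theta mu w) =
  (1 - theta) * spread F mu + theta * spread F w
  + theta * (1 - theta) * sqdist (mix F mu) (mix F w).
Proof.
move=> t01 muS wS; have sS := simplex_segment t01 muS wS.
have := huygens F (mix F mu) sS.
rewrite wavg_segment sqdist_segment !huygens// sqdistxx => h; lra.
Qed.

(** All terms but [(1 - nu) * sqdist y (mix F lam)] are linear, so the defect of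
    affinity is that of a square distance. *)
Lemma penalized_segment (R : realType) (n M : nat) (F : 'I_M -> 'I_n -> R)
    (nu : R) (c : 'I_M -> R) (y : 'I_n -> R) (alpha : R) (mu w : 'rV[R]_M) :
  penalized F nu c y (segment alpha mu w) =
  (1 - alpha) * penalized F nu c y mu + alpha * penalized F nu c y w
  - (1 - nu) * (alpha * (1 - alpha)) * sqdist (mix F mu) (mix F w).
Proof. by rewrite /penalized !wavg_segment sqdist_segment; ring. Qed.

Lemma penalizedE (R : realType) (n M : nat) (F : 'I_M -> 'I_n -> R)
    (nu : R) (c : 'I_M -> R) (y : 'I_n -> R) (lam : 'rV[R]_M) :
  simplex R M lam ->
  penalized F nu c y lam =
  sqdist y (mix F lam) + nu * spread F lam + wavg lam c.
Proof. by move=> lamS; rewrite /penalized huygens//; ring. Qed.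

Lemma penalized_delta (R : realType) (n M : nat) (F : 'I_M -> 'I_n -> R)
    (nu : R) (c : 'I_M -> R) (y : 'I_n -> R) (j : 'I_M) :
  penalized F nu c y (delta_mx 0 j) = sqdist y (F j) + c j.
Proof.
by rewrite penalizedE ?spread_delta ?mix_delta ?wavg_delta;
  [ring|exact: simplex_delta].
Qed.

(** What replaces a move in the direction [w].  The values at the vertices
    exceed the value at [w] by [(1 - nu) * spread F w] on average; the curvature
    of the criterion gives back the fraction [1 - alpha] of this excess, so that it
    enters with the factor [alpha ^+ 2] rather than [alpha]. *)
Lemma wavg_penalized_step (R : realType) (n M : nat) (F : 'I_M -> 'I_n -> R)
    (nu : R) (c : 'I_M -> R) (y : 'I_n -> R) (alpha : R) (mu w : 'rV[R]_M) :
  nu <= 1 -> 0 <= alpha <= 1 -> simplex R M w ->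
  wavg w (fun j => penalized F nu c y (segment alpha mu (delta_mx 0 j))) <=
  (1 - alpha) * penalized F nu c y mu + alpha * penalized F nu c y w
  + (1 - nu) * alpha ^+ 2 * spread F w.
Proof.
move=> nu1 a01 wS.
have -> : (fun j => penalized F nu c y (segment alpha mu (delta_mx 0 j))) =
    fun j => (1 - alpha) * penalized F nu c y mu
      + (alpha * (sqdist y (F j) + c j)
      + (- ((1 - nu) * (alpha * (1 - alpha)))) * sqdist (mix F mu) (F j)).
  apply/funext => j.
  by rewrite penalized_segment penalized_delta mix_delta; ring.
rewrite !wavgD wavg_cst// (wavgZ w alpha) wavgD.
rewrite (wavgZ w (- ((1 - nu) * (alpha * (1 - alpha))))) !huygens//.
rewrite (penalizedE F nu c y wS).
have : 0 <= (1 - nu) * (alpha * (1 - alpha)) * sqdist (mix F mu) (mix F w).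
  apply: mulr_ge0; last exact: sqdist_ge0.
  by apply: mulr_ge0; [lra|apply: mulr_ge0; lra].
lra.
Qed.

(** The induction step behind the rate [4 / (s + 3)]; it is an equality for
    [s = 1], which starts the induction. *)
Lemma greedy_rate_arith (R : realFieldType) (s : nat) : (0 < s)%N ->
  (1 - 2 / s.+1%:R) * (4 / (s + 2)%:R) + (2 / s.+1%:R) ^+ 2
    <= 4 / (s + 3)%:R :> R.
Proof.
move=> s0; have s1 : 1 <= s%:R :> R by rewrite ler1n.
rewrite -[s.+1]addn1 !natrD; move: (s%:R : R) s1 => t t1.
rewrite -subr_ge0 (_ : _ - _ =
    4 * (t - 1) / ((t + 3) * (t + 2) * (t + 1) ^+ 2)); last first.
  by field; rewrite !gt_eqF//; lra.
by apply: divr_ge0; [lra|rewrite !mulr_ge0 ?exprn_ge0//; lra].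
Qed.

(** * The rate of greedy descent *)

Definition dominated (R : realType) (M : nat) (prior lam : 'rV[R]_M) : Prop :=
  forall j, prior 0 j = 0 -> lam 0 j = 0.

Definition prior_cost (R : realType) (M : nat) (tau : R) (prior : 'rV[R]_M)
    (j : 'I_M) : R := tau * - ln (prior 0 j).

Lemma log_inv_gt0 (R : realType) (u : R) : 0 < u -> log_inv u = (- ln u)%:E.
Proof.
move=> u0; rewrite /log_inv inver gt_eqF// lne_EFin ?invr_gt0//.
by rewrite lnV// posrE.
Qed.

Lemma log_inv0 (R : realType) : log_inv (0 : R) = +oo%E.
Proof. by rewrite /log_inv inve0. Qed.

Lemma simplex_le1 (R : realType) (M : nat) (lam : 'rV[R]_M) (j : 'I_M) :
  simplex R M lam -> lam 0 j <= 1.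
Proof.
by move=> [l0 <-]; rewrite (bigD1 j)//= lerDl sumr_ge0.
Qed.

Lemma log_inv_ge0 (R : realType) (M : nat) (prior : 'rV[R]_M) (j : 'I_M) :
  simplex R M prior -> (0 <= log_inv (prior 0 j)%R)%E.
Proof.
move=> priorS; have [/(_ j)] := priorS.
rewrite le_eqVlt => /orP[/eqP <- _|p0 _].
  by rewrite log_inv0.
by rewrite log_inv_gt0// lee_fin oppr_ge0 ln_le0// simplex_le1.
Qed.

Lemma objective_dominated (R : realType) (X : Type) (n M : nat) (x : 'I_n -> X)
    (f : 'I_M -> X -> R) (nu beta : R) (prior : 'rV[R]_M) (y : n.-tuple R)
    (lam : 'rV[R]_M) :
  (forall j, 0 <= prior 0 j) -> dominated prior lam ->
  objective x f nu beta prior y lam =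
  (penalized (fun j i => f j (x i)) nu (prior_cost (beta / n%:R) prior) (tnth y)
     lam)%:E.
Proof.
move=> p0 domlam; rewrite /objective /penalized !EFinD; congr (_ + _)%E.
rewrite /prior_cost (wavgZ _ (beta / n%:R)) [RHS]EFinM /wavg -sumEFin.
congr (_ * _)%E.
apply: eq_bigr => j _.
have := p0 j; rewrite le_eqVlt => /orP[/eqP pj|pj].
  by rewrite domlam// mul0e mul0r.
by rewrite log_inv_gt0.
Qed.

(** A single vertex of null prior and positive weight makes the objective
    infinite, so the greedy steps never choose one. *)
Lemma objective_finite_dominated (R : realType) (X : Type) (n M : nat)
    (x : 'I_n -> X) (f : 'I_M -> X -> R) (nu beta : R) (prior : 'rV[R]_M)
    (y : n.-tuple R) (lam : 'rV[R]_M) :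
  0 < beta / n%:R -> simplex R M prior -> simplex R M lam ->
  (objective x f nu beta prior y lam < +oo)%E -> dominated prior lam.
Proof.
move=> b0 priorS lamS fin j pj; apply/eqP/negP => lamj; move: fin.
have lam0 := lamS.1.
have lamj0 : 0 < lam 0 j by rewrite lt_def lam0 andbT; apply/negP.
rewrite /objective [X in (_ * X)%E](bigD1 j)//= pj log_inv0.
rewrite gt0_muley ?lte_fin//.
rewrite addye.
  by rewrite [X in (_ + X)%E]gt0_muley ?lte_fin// -EFinD addey// ltxx.
rewrite -ltNye (@lt_le_trans _ _ 0%E)// sume_ge0// => i _.
by rewrite mule_ge0 ?lee_fin// log_inv_ge0.
Qed.

Lemma simplex_support (R : realType) (M : nat) (prior : 'rV[R]_M) :
  simplex R M prior -> exists j, 0 < prior 0 j.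
Proof.
move=> [p0 p1]; have : 0 < \sum_j prior 0 j by rewrite p1.
rewrite lt_def sumr_ge0// andbT => /eqP h.
have [//|np] := pselect (exists j, 0 < prior 0 j).
case: h; apply: big1 => j _; apply/eqP; apply: contra_notT np => pj.
by exists j; rewrite lt_def pj p0.
Qed.

Lemma segment1 (R : realType) (M : nat) (mu w : 'rV[R]_M) : segment 1 mu w = w.
Proof. by rewrite /segment scale1r addrC subrK. Qed.

Lemma step_size_itv (R : realType) (s : nat) : (0 < s)%N ->
  0 <= (2 / s.+1%:R : R) <= 1.
Proof.
move=> s0; rewrite divr_ge0//= ler_pdivrMr ?ltr0n// mul1r ler_nat//.
Qed.

Lemma simplex_greedy_move (R : realType) (M : nat) (s : nat) (lam : 'rV[R]_M)
    (j : 'I_M) : (0 < s)%N -> (s != 1%N -> simplex R M lam) ->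
  simplex R M (greedy_move s lam j).
Proof.
move=> s0; have [-> _|_ /(_ isT) lamS] := eqVneq s 1%N.
  rewrite /greedy_move divff ?pnatr_eq0//.
  by rewrite -/(segment _ _ _) segment1; exact: simplex_delta.
by apply: simplex_segment => //; [exact: step_size_itv|exact: simplex_delta].
Qed.

Lemma dominated_greedy_move (R : realType) (M : nat) (s : nat)
    (prior lam : 'rV[R]_M) (j : 'I_M) : prior 0 j != 0 ->
  dominated prior lam -> dominated prior (greedy_move s lam j).
Proof.
move=> pj domlam i pi; rewrite !mxE domlam// eqxx/=.
rewrite (_ : (i == j) = false) ?subr0 ?mulr0 ?addr0//.
by apply: contraNF pj => /eqP <-; rewrite pi.
Qed.

(** The common part of both algorithms on which the analysis rests. *)
Definition greedy_descent (R : realType) (M : nat) (Q : 'rV[R]_M -> \bar R)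
    (k : nat) (lam : nat -> 'rV[R]_M) : Prop :=
  lam 0%N = 0 /\
  forall s, (1 <= s <= k)%N -> simplex R M (lam s) /\
    forall j, (Q (lam s) <= Q (greedy_move s (lam s.-1) j))%E.

Lemma GMA0_descent (R : realType) (M : nat) (Q : 'rV[R]_M -> \bar R) (k : nat)
    (J : nat -> 'I_M) (lam : nat -> 'rV[R]_M) :
  GMA0 Q k J lam -> greedy_descent Q k lam.
Proof.
move=> [lam0 run]; split=> // s /[dup] sk /run[[_ Jmin] lamE].
split=> [|j]; last by rewrite lamE; exact: Jmin.
elim: s sk {Jmin} lamE => // s IH sk ->; apply: simplex_greedy_move => //= s0.
have sk' : (1 <= s <= k)%N.
  by case/andP: sk => _ /ltnW ->; rewrite andbT lt0n; move: s0; rewrite eqSS.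
exact: IH (run _ sk').2.
Qed.

(** The greedy move is a competitor in the fully corrective minimization: its
    weights lie on the vertices chosen so far. *)
Lemma GMA0plus_descent (R : realType) (M : nat) (Q : 'rV[R]_M -> \bar R)
    (k : nat) (J : nat -> 'I_M) (lam : nat -> 'rV[R]_M) :
  GMA0plus Q k J lam -> greedy_descent Q k lam.
Proof.
move=> [lam0 run]; split=> // s /[dup] sk /run[[_ Jmin] [[lamS _] lamin]].
split=> // j; apply: le_trans (Jmin j _) => //; apply: lamin; split.
  apply: simplex_greedy_move => [|s1]; first by case/andP: sk.
  have : (1 <= s.-1 <= k)%N.
    by case: (s) sk s1 => [|[|s']]//= /ltnW ->.
  by move=> /run[_ [[]]].
move=> i iJ; have s0 : (0 < s)%N by case/andP: sk.
have iJs : i != J s by apply/eqP; apply: iJ; rewrite s0 leqnn.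
rewrite !mxE (negbTE iJs) andbF.
suff -> : lam s.-1 0 i = 0 by rewrite subrr mulr0 addr0.
have [s1|s1] := eqVneq s.-1 0%N; first by rewrite s1 lam0 mxE.
have : (1 <= s.-1 <= k)%N.
  by rewrite lt0n s1 (leq_trans (leq_pred _))//; case/andP: sk.
move=> /run[_ [[_ supp] _]]; apply: supp => r /andP[r0 rs]; apply: iJ.
by rewrite r0 (leq_trans rs)// leq_pred.
Qed.

(** The best vertex does at least as well as the [w]-average of the vertices, so
    [wavg_penalized_step] yields a recursion for the excess over [w].  The
    vertices where [w] vanishes are left out of the average, as the objective
    may be infinite there. *)
Lemma greedy_rate (R : realType) (X : Type) (n M k : nat) (x : 'I_n -> X)
    (f : 'I_M -> X -> R) (nu beta : R) (prior : 'rV[R]_M) (y : n.-tuple R)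
    (lam : nat -> 'rV[R]_M)
    (F := fun j i => f j (x i))
    (q := penalized F nu (prior_cost (beta / n%:R) prior) (tnth y)) :
  0 < beta / n%:R -> nu <= 1 -> simplex R M prior ->
  greedy_descent (objective x f nu beta prior y) k lam ->
  forall s, (1 <= s <= k)%N -> dominated prior (lam s) /\
    forall w, simplex R M w -> dominated prior w ->
      q (lam s) <= q w + 4 * (1 - nu) / (s + 3)%:R * spread F w.
Proof.
move=> b0 nu1 priorS [lam0 run].
have p0 := priorS.1.
have dom s : (s <= k)%N -> dominated prior (lam s).
  elim: s => [_ j _|s IH sk]; first by rewrite lam0 mxE.
  have [lamS desc] := run s.+1 sk.
  have [j pj] := simplex_support priorS.
  apply: (objective_finite_dominated b0 priorS lamS).
  apply: le_lt_trans (desc j) _.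
  rewrite objective_dominated ?ltry//.
  apply: dominated_greedy_move; first by rewrite gt_eqF.
  exact/IH/ltnW.
elim=> // s IH sk; split; first by apply: dom; case/andP: sk.
move=> w wS domw.
have [lamS desc] := run _ sk.
have domlam : dominated prior (lam s) by apply: dom; case/andP: sk => _ /ltnW.
have a01 := step_size_itv R (ltn0Sn s).
have step : q (lam s.+1) <=
    wavg w (fun j => q (segment (2 / s.+2%:R) (lam s) (delta_mx 0 j))).
  rewrite -[leLHS](wavg_cst _ wS); apply: ler_wavg => // j wj.
  have := desc j; rewrite /= !objective_dominated ?lee_fin//; last exact: dom.
  by apply: dominated_greedy_move => //; apply: contra_neq wj; exact: domw.
have := le_trans step (wavg_penalized_step _ _ _ _ nu1 a01 wS).
set a : R := 2 / s.+2%:R in a01 *; rewrite -/(q _) -/(q _) => {}step.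
have rate : (1 - a) * q (lam s) <= (1 - a) *
    (q w + 4 * (1 - nu) / (s.+1 + 2)%:R * spread F w).
  have [s0|s0] := eqVneq s 0%N.
    by rewrite /a s0 divff ?pnatr_eq0// subrr !mul0r.
  have sk' : (1 <= s <= k)%N.
    by rewrite lt0n s0; case/andP: sk => _ /ltnW.
  apply: ler_wpM2l; first by case/andP: a01; rewrite subr_ge0.
  by have [_ /(_ w wS domw)] := IH sk'; rewrite -[(s + 3)%N]addSnnS.
have arith := greedy_rate_arith R (ltn0Sn s); rewrite -/a in arith.
have V0 : 0 <= (1 - nu) * spread F w by rewrite mulr_ge0 ?spread_ge0 ?subr_ge0.
have := ler_wpM2r V0 arith.
move: step rate; set u := _^-1; set v := _^-1; move: (spread F w) => V.
by move=> *; lra.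
Qed.

(** Comparing with a point of the chord rather than with the vertex itself is
    what makes the curvature of the criterion available at [lam], which is only
    an approximate minimizer.  Divide the inequality by [theta]. *)
Lemma chord_oracle (R : realType) (n M k : nat) (F : 'I_M -> 'I_n -> R)
    (nu theta : R) (c : 'I_M -> R) (y : 'I_n -> R) (lam : 'rV[R]_M) (j : 'I_M) :
  0 < theta <= 1 -> simplex R M lam ->
  (let w := segment theta lam (delta_mx 0 j) in
   penalized F nu c y lam <= penalized F nu c y w
     + 4 * (1 - nu) / (k + 3)%:R * spread F w) ->
  sqdist y (mix F lam) + wavg lam c + theta_gap nu k theta * spread F lam
    + (1 - theta) * (1 - nu) * (1 - 4 / (k + 3)%:R) * sqdist (mix F lam) (F j)
  <= sqdist y (F j) + c j.
Proof.
move=> t01 lamS /=; have t0 : 0 < theta by case/andP: t01.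
have t01' : 0 <= theta <= 1 by case/andP: t01 => /ltW ->.
rewrite penalized_segment spread_segment//; last exact: simplex_delta.
rewrite spread_delta penalized_delta mix_delta penalizedE// /theta_gap.
rewrite invfM; set u := (k + 3)%:R^-1; set D := sqdist (mix _ _) _.
set V := spread _ _ => h; rewrite -(ler_pM2l t0).
rewrite -subr_ge0 in h; rewrite -subr_ge0.
apply: le_trans h _; rewrite le_eqVlt; apply/orP; left; apply/eqP.
by field; rewrite gt_eqF.
Qed.

(** * The lower bound on the temperature *)

(** Holds because [theta_gap] never exceeds [nu]; it is what forces [beta] to be
    positive. *)
Lemma beta_factor_ge (R : realType) (nu : R) (k : nat) : 0 < nu <= 1 ->
  ((nu^-1)%:E <= beta_factor nu k)%E.
Proof.
move=> /andP[nu0 nu1].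
apply: le_ereal_inf_tmp => _ [theta [/andP[t0 t1] gap0]] <-.
rewrite le_max inver gt_eqF//= lee_fin; apply/orP; left.
rewrite lef_pV2 ?posrE// /theta_gap lerBlDr lerDl.
by rewrite divr_ge0 ?mulr_ge0//; lra.
Qed.

(** For every [m] above [beta_factor nu k], some [theta] has both coefficients
    at least [m^-1], hence [V + D <= m * B]; then let [m] decrease. *)
Lemma beta_factor_bound (R : realType) (nu beta sigma V D B : R) (k : nat) :
  (2 <= k)%N -> 0 < nu < 1 -> 0 < sigma -> 0 <= V -> 0 <= D ->
  ((2 * sigma ^+ 2)%:E * beta_factor nu k <= beta%:E)%E ->
  (forall theta, 0 < theta <= 1 -> 0 < theta_gap nu k theta ->
     theta_gap nu k theta * V
     + (1 - theta) * (1 - nu) * (1 - 4 / (k + 3)%:R) * D <= B) ->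
  2 * sigma ^+ 2 * (V + D) <= beta * B.
Proof.
move=> k2 /andP[nu0 nu1] s0 V0 D0 betaE HB.
have s20 : 0 < 2 * sigma ^+ 2 by rewrite mulr_gt0// exprn_gt0.
move: betaE; rewrite -lee_pdivlMl// -EFinM => betaE.
rewrite -ler_pdivlMl// mulrA; set t := _^-1 * beta in betaE *.
have bound (e : R) : 0 < e -> 0 <= B /\ V + D <= (t + e) * B.
  move=> e0; have : (beta_factor nu k < (t + e)%:E)%E.
    by apply: le_lt_trans betaE _; rewrite lte_fin ltrDl.
  move=> /ereal_inf_lt[_ [theta [/andP[t0 t1] gap0]] <-].
  have HBt := HB theta; rewrite t0 t1 gap0 in HBt; move: (HBt isT isT).
  have c0 : 0 <= (1 - theta) * (1 - nu) * (1 - 4 / (k + 3)%:R).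
    apply: mulr_ge0; first by rewrite mulr_ge0// subr_ge0// ltW.
    have k3 : 0 < (k + 3)%:R :> R by rewrite ltr0n addn3.
    rewrite subr_ge0 ler_pdivrMr// mul1r ler_nat.
    exact: (leq_trans _ (leq_add k2 (leqnn 3))). 
  move: c0 gap0; set c := (_ * _ * _); set g := theta_gap _ _ _ => c0 gap0 gB.
  rewrite gt_max !inver gt_eqF//= lte_fin.
  case: (eqVneq c 0) => [_|cn0]; first by rewrite andbF.
  have cp : 0 < c by rewrite lt_def cn0.
  rewrite lte_fin => /andP[gm cm].
  have gV0 : 0 <= g * V by rewrite mulr_ge0// ltW.
  have cD0 : 0 <= c * D by rewrite mulr_ge0.
  split; first by lra.
  have m0 : 0 < t + e by apply: le_lt_trans gm; rewrite invr_ge0 ltW.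
  apply: le_trans (ler_wpM2l (ltW m0) gB); rewrite mulrDr.
  rewrite (mulrA _ g) (mulrA _ c) lerD//.
    rewrite ler_peMl// -(mulVf (lt0r_neq0 gap0)) ler_wpM2r ?(ltW gap0)//.
    exact: ltW.
    rewrite ler_peMl// -(mulVf cn0) ler_wpM2r//.
  exact: ltW.
have B0 : 0 <= B by have [] := bound 1 ltr01.
apply/ler_addgt0Pr => e e0.
have B1 : 0 < B + 1 by lra.
have [_ h] := bound (e / (B + 1)) (divr_gt0 e0 B1).
apply: le_trans h _; rewrite mulrDl lerD2l -mulrA ler_piMr ?(ltW e0)//.
by rewrite ler_pdivrMl// mulr1; lra.
Qed.

(** * Integrals of products of independent variables *)

(** Reduces the integral of a simple function of [Y] with weight [H] to the
    weighted law of [Y]. *)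
Lemma integral_mul_nnsfun_comp (d : measure_display) (T : measurableType d)
    (R : realType) (P : probability T R) (H : T -> R) (Y : {RV P >-> R})
    (phi : {nnsfun R >-> R}) :
  measurable_fun setT H -> (forall w, 0 <= H w) ->
  (\int[P]_w (H w * phi (Y w))%:E =
   \sum_(y \in range phi)
     (y%:E * \int[P]_w (H w * \1_(phi @^-1` [set y]) (Y w))%:E))%E.
Proof.
move=> mH H0.
have mI (y : R) : measurable_fun setT
    (fun w => H w * \1_(phi @^-1` [set y]) (Y w)).
  apply: measurable_funM => //.
  apply: measurableT_comp => //.
have I0 (y : R) w : 0 <= y * (H w * \1_(phi @^-1` [set y]) (Y w)).
  rewrite mulrCA mulr_ge0//.
  by have := nnfun_muleindic_ge0 phi y (Y w); rewrite -EFinM lee_fin.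
transitivity (\int[P]_w (\sum_(y \in range phi)
    (y * (H w * \1_(phi @^-1` [set y]) (Y w)))%:E))%E.
  apply: eq_integral => w _; rewrite fsumEFin//; congr EFin.
  rewrite [in LHS](fimfunE phi) !fsbig_finite//= mulr_sumr.
  by apply: eq_bigr => y _; rewrite mulrCA.
rewrite ge0_integral_fsum//.
- apply: eq_fsbigr => y /[!inE] -[z _ <-].
  under eq_integral do rewrite EFinM.
  rewrite ge0_integralZl//.
  + exact/measurable_EFinP.
  + by move=> w _; rewrite lee_fin mulr_ge0.
  + by rewrite lee_fin.
- by move=> y; apply/measurable_EFinP; exact: measurable_funM.
- by move=> y w _; rewrite lee_fin I0.
Qed.

(** If the law of [Y] weighted by [H] is [c] times the law of [Y], the same
    holds when integrating against it: pass to the limit along simple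
    functions.  As [c] may be infinite and the product of extended reals is
    discontinuous at [0 * +oo], the cases [c = 0] and [\int g (Y) = 0] are
    separated. *)
Lemma integral_mul_comp (d : measure_display) (T : measurableType d)
    (R : realType) (P : probability T R) (H : T -> R) (Y : {RV P >-> R})
    (c : \bar R) (g : R -> R) :
  measurable_fun setT H -> (forall w, 0 <= H w) -> (0 <= c)%E ->
  (forall A, measurable A ->
     (\int[P]_w (H w * \1_A (Y w))%:E = c * \int[P]_w (\1_A (Y w))%:E)%E) ->
  measurable_fun setT g -> (forall z, 0 <= g z) ->
  (\int[P]_w (H w * g (Y w))%:E = c * \int[P]_w (g (Y w))%:E)%E.
Proof.
move=> mH H0 c0 HA mg g0.
have mEg : measurable_fun setT (EFin \o g) by exact/measurable_EFinP.
pose phi := nnsfun_approx measurableT mEg.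
have simple n : (\int[P]_w (H w * phi n (Y w))%:E =
    c * \int[P]_w (phi n (Y w))%:E)%E.
  rewrite integral_mul_nnsfun_comp//.
  have -> : (\int[P]_w (phi n (Y w))%:E = \int[P]_w (1 * phi n (Y w))%:E)%E.
    by under [RHS]eq_integral do rewrite mul1r.
  rewrite (@integral_mul_nnsfun_comp _ _ _ _ (cst 1))//.
  rewrite ge0_mule_fsumr; last first.
    move=> y; rewrite /=; under eq_integral do rewrite mul1r.
    have [y0|y0] := leP 0 y.
      by rewrite mule_ge0 ?lee_fin// integral_ge0.
    rewrite preimage_nnfun0//.
    by under eq_integral do rewrite indic0; rewrite integral0 mule0.
  apply: eq_fsbigr => y _; rewrite HA//= muleCA.
  by under [in RHS]eq_integral do rewrite mul1r.
have mphi n : measurable_fun setT (fun w => phi n (Y w)).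
  exact: measurableT_comp.
have phi_nd w : nondecreasing_seq (fun n => phi n (Y w)).
  by move=> m n mn; have /lefP := nd_nnsfun_approx measurableT mEg mn; exact.
have cvg_weight (K : T -> R) : measurable_fun setT K -> (forall w, 0 <= K w) ->
    (\int[P]_w (K w * phi n (Y w))%:E @[n --> \oo] -->
     \int[P]_w (K w * g (Y w))%:E)%E.
  move=> mK K0.
  have -> : (\int[P]_w (K w * g (Y w))%:E =
      \int[P]_w limn (fun n => (K w * phi n (Y w))%:E))%E.
    apply: eq_integral => w _; apply/esym/cvg_lim => //.
    under eq_fun do rewrite EFinM.
    rewrite EFinM; apply: cvgeZl => //.
    exact: (@cvg_nnsfun_approx _ _ _ _ measurableT _ mEg (fun z _ => g0 z)).
  apply: cvg_monotone_convergence => //.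
  - by move=> n; apply/measurable_EFinP; exact: measurable_funM.
  - by move=> n w _; rewrite lee_fin mulr_ge0.
  - by move=> w _ m n mn; rewrite lee_fin ler_wpM2l// phi_nd.
have cvgH := cvg_weight H mH H0.
have cvg1 : (\int[P]_w (phi n (Y w))%:E @[n --> \oo] -->
    \int[P]_w (g (Y w))%:E)%E.
  have := cvg_weight (cst 1) (measurable_cst _) (fun=> ler01).
  under eq_fun do under eq_integral do rewrite mul1r.
  by under [X in _ --> X]eq_integral do rewrite mul1r.
rewrite (funext simple) in cvgH.
apply: (cvg_unique _ cvgH); first exact: ereal_hausdorff.
suff: (c * \int[P]_w (phi n (Y w))%:E @[n --> \oo] -->
  c * \int[P]_w (g (Y w))%:E)%E by [].
have [->|c1] := eqVneq c 0%E.
   suff -> : (fun n => 0 * \int[P]_w (phi n (Y w))%:E)%E = cst 0%E.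
    by rewrite mul0e; exact: cvg_cst.
  by apply/funext => n; rewrite mul0e.
have [I0|I0] := eqVneq (\int[P]_w (g (Y w))%:E)%E 0%E; last first.
  by apply: cvgeM => //; [rewrite neq0_mule_def// mule_neq0|exact: cvg_cst].
have phi_int0 n : (\int[P]_w (phi n (Y w))%:E = 0)%E.
  apply/eqP; rewrite eq_le; apply/andP; split; last first.
    by apply: integral_ge0 => w _; rewrite lee_fin.
  rewrite -I0; apply: ge0_le_integral => //.
  - by move=> w _; rewrite lee_fin.
  - exact/measurable_EFinP.
  - by apply/measurable_EFinP; exact: measurableT_comp.
  - move=> w _; rewrite /phi nnsfun_approxE.
    by apply: (@le_approx _ _ _ setT (EFin \o g)) => // z _; rewrite lee_fin.
suff -> : (fun n => c * \int[P]_w (phi n (Y w))%:E)%E = cst 0%E.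
  by rewrite I0 mule0; exact: cvg_cst.
by apply/funext => n; rewrite phi_int0 mule0.
Qed.

(** Independence is the case where all [g i] are indicators; arbitrary factors
    are introduced one at a time, the others serving as the weight in
    [integral_mul_comp]. *)
Lemma independent_integral_prod (d : measure_display) (T : measurableType d)
    (R : realType) (P : probability T R) (m : nat) (Z : 'I_m -> {RV P >-> R})
    (g : 'I_m -> R -> R) :
  independent_RVs Z -> (forall i, measurable_fun setT (g i)) ->
  (forall i z, 0 <= g i z) ->
  (\int[P]_w (\prod_(i < m) g i (Z i w))%:E =
   \prod_(i < m) \int[P]_w (g i (Z i w))%:E)%E.
Proof.
move=> indep mg g0.
suff main r (h : 'I_m -> R -> R) : (forall i, measurable_fun setT (h i)) ->
    (forall i z, 0 <= h i z) ->
    (forall i : 'I_m, (r <= i)%N -> exists2 A, measurable A & h i = \1_A) ->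
    (\int[P]_w (\prod_(i < m) h i (Z i w))%:E =
     \prod_(i < m) \int[P]_w (h i (Z i w))%:E)%E.
  by apply: (main m) => // i; rewrite leqNgt ltn_ord.
elim: r h => [|r IH] h mh h0 indic_h.
  have /choice[A hA] i : exists A, measurable A /\ h i = \1_A.
    by have [//|A mA hiA] := indic_h i; exists A.
  have mA i : measurable (A i) by have [] := hA i.
  have mZA i : measurable (Z i @^-1` A i).
    by rewrite -[_ @^-1` _]setTI; exact: measurable_funPT.
  have hE i w : h i (Z i w) = \1_(Z i @^-1` A i) w.
    by have [_ ->] := hA i; rewrite !indicE; congr (_%:R).
  have -> : (\int[P]_w (\prod_(i < m) h i (Z i w))%:E =
      \int[P]_w
        (\1_(\bigcap_(i in [set` [set: 'I_m]%SET]) (Z i @^-1` A i)) w)%:E)%E.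
    apply: eq_integral => w _; congr EFin.
    under eq_bigr do rewrite hE.
    rewrite indicE; have [wA|wA] := boolP (w \in _).
      apply: big1 => i _; rewrite indicE mem_set//.
      by move: wA; rewrite inE; apply; rewrite /= finset.in_setT.
    move: wA; rewrite notin_setE /bigcap/= => /existsNP[i nA].
    rewrite (bigD1 i)//= indicE memNset ?mul0r//.
  rewrite integral_indic//; last by apply: fin_bigcap_measurable.
  rewrite setIT; apply: etrans (indep [set: 'I_m]%SET A mA) _.
  apply: eq_big => [i|i _]; first by rewrite finset.in_setT.
  under eq_integral do rewrite hE.
  by rewrite integral_indic// setIT.
have [mr|rm] := leqP m r.
  apply: IH => // i ri; have := ltn_ord i.
  by rewrite ltnNge (leq_trans mr ri).
pose i0 := Ordinal rm.
rewrite [RHS](bigD1 i0)//= muleC.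
under eq_integral do rewrite (bigD1 i0)//= mulrC.
apply: (integral_mul_comp (H := fun w => \prod_(i < m | i != i0) h i (Z i w))).
- under eq_fun do rewrite big_mkcond.
  apply: measurable_prod => i _; case: (i != i0); last exact: measurable_cst.
  exact: measurableT_comp.
- by move=> w; apply: prodr_ge0.
- by apply: prode_ge0 => i _; apply: integral_ge0 => w _; rewrite lee_fin.
- move=> A mA.
  pose h' i := if i == i0 then \1_A else h i.
  have h'E i : i != i0 -> h' i = h i by rewrite /h' => /negbTE ->.
  have h'0 : h' i0 = \1_A by rewrite /h' eqxx.
  have := IH h'; rewrite (bigD1 i0)//= h'0 muleC.
  under [X in (_ -> _ -> _ -> _ = X * _)%E -> _]eq_bigr => i ii0.
    rewrite h'E//. over.
  under eq_integral => w _.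
    rewrite (bigD1 i0)//= h'0 mulrC.
    under eq_bigr => i ii0 do rewrite h'E//.
    over.
  apply.
  + by move=> i; rewrite /h'; case: eqVneq => _ //; exact: measurable_indic.
  + by move=> i z; rewrite /h'; case: eqVneq => _ //; rewrite indicE ler0n.
  + move=> i ri; rewrite /h'; case: eqVneq => [_|ii0]; first by exists A.
    by apply: indic_h; rewrite ltn_neqAle ri andbT eq_sym.
- exact: mh.
- exact: h0.
Qed.

(** * From random weights to the prior *)

Lemma lee_prod (R : realType) (I : Type) (r : seq I) (a b : I -> \bar R) :
  (forall i, 0 <= a i <= b i)%E ->
  (\prod_(i <- r) a i <= \prod_(i <- r) b i)%E.
Proof.
move=> ab.
suff /andP[] : (0 <= \prod_(i <- r) a i <= \prod_(i <- r) b i)%E by [].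
apply: (big_ind2 (fun u v => 0 <= u <= v)%E) => [|u v u' v'|i _] //.
  by rewrite lee01 lexx.
move=> /andP[u0 uv] /andP[u'0 u'v']; rewrite mule_ge0//=.
exact: lee_pmul.
Qed.

Lemma independent_sub_gaussian (d : measure_display) (T : measurableType d)
    (R : realType) (P : probability T R) (m : nat) (Z : 'I_m -> {RV P >-> R})
    (proxy : R) :
  independent_RVs Z ->
  (forall i, sub_gaussian P (fun _ : 'I_1 => Z i : T -> R) proxy) ->
  sub_gaussian P (fun i => Z i : T -> R) proxy.
Proof.
move=> indep subg t; rewrite unlock.
under eq_integral do rewrite expR_sum.
rewrite (independent_integral_prod (g := fun i z => expR (t 0 i * z)))//;
  last first.
  move=> i; apply: measurableT_comp; first exact: measurable_expR.
  exact: measurable_funM.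
rewrite mulr_sumr mulr_suml expR_sum -prodEFin; apply: lee_prod => i.
rewrite integral_ge0/=; last by move=> w _; rewrite lee_fin expR_ge0.
have := subg i (\row_(_ < 1) t 0 i); rewrite unlock big_ord1 mxE.
by under eq_integral do rewrite big_ord1 mxE.
Qed.

(** The Donsker-Varadhan inequality: [wavg lam z] exceeds
    [ln (wavg prior (expR \o z))] by at most the relative entropy of [lam], here
    weakened by dropping the nonnegative Shannon entropy of [lam]. *)
Lemma donsker_varadhan (R : realType) (M : nat) (prior lam : 'rV[R]_M)
    (z : 'I_M -> R) :
  simplex R M prior -> simplex R M lam -> dominated prior lam ->
  expR (wavg lam (fun i => z i + ln (prior 0 i))) <=
  wavg prior (fun i => expR (z i)).
Proof.
move=> priorS lamS domlam; set u := wavg _ _.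
have [p0 _] := priorS; have [l0 l1] := lamS.
(* The tangent to exp at [u]; replacing the weight [lam 0 i <= 1] by 1 on the
   exponential side is what drops the entropy of [lam]. *)
have tangent i : lam 0 i * (expR u * (1 + (z i + ln (prior 0 i) - u)))
    <= prior 0 i * expR (z i).
  have [p0i|pi] := eqVneq (prior 0 i) 0.
    by rewrite domlam// p0i !mul0r.
  have pi0 : 0 < prior 0 i by rewrite lt_def pi p0.
  have -> : prior 0 i * expR (z i) = expR u * expR (z i + ln (prior 0 i) - u).
    by rewrite -expRD addrC subrK expRD lnK ?posrE// mulrC.
  have le1 : lam 0 i <= 1 by exact: simplex_le1.
  apply: (@le_trans _ _ (lam 0 i * (expR u * expR (z i + ln (prior 0 i) - u)))).
    by rewrite ler_wpM2l// ler_wpM2l ?expR_ge0// expR_ge1Dx.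
  by rewrite ler_piMl// mulr_ge0 ?expR_ge0.
apply: le_trans (ler_sum _ (fun i _ => tangent i)).
rewrite -/(wavg lam (fun i => expR u * (1 + (z i + ln (prior 0 i) - u)))).
rewrite (wavgZ _ (expR u)) !wavgD !wavg_cst// -wavgD -/u.
by rewrite subrr addr0 mulr1.
Qed.

(** Each exponent is compensated by the sub-Gaussian bound on its own Laplace
    transform, so that the mean is at most 1 ([integral_exp_weight_le1]). *)
Definition exp_weight (R : realType) (n M : nat) (F : 'I_M -> 'I_n -> R)
    (sigma beta : R) (prior : 'rV[R]_M) (noise : 'I_n -> R) (j : 'I_M) : R :=
  wavg prior (fun i => expR (2 / beta * \sum_(l < n) noise l * (F i l - F j l)
    - 2 * sigma ^+ 2 * n%:R / beta ^+ 2 * sqdist (F j) (F i))).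

Lemma sqdist_noise (R : realType) (n : nat) (u y v w : 'I_n -> R) :
  sqdist (fun l => u l + y l) v - sqdist (fun l => u l + y l) w =
  sqdist u v - sqdist u w + 2 / n%:R * \sum_(l < n) y l * (w l - v l).
Proof.
rewrite /sqdist [2 / _]mulrC -(mulrA _ 2) -!mulrBr -mulrDr mulr_sumr -!sumrB.
by rewrite -big_split; congr (_ * _); apply: eq_bigr => l _ /=; ring.
Qed.

Lemma sum_mix (R : realType) (n M : nat) (F : 'I_M -> 'I_n -> R)
    (lam : 'rV[R]_M) (y v : 'I_n -> R) : simplex R M lam ->
  \sum_(l < n) y l * (mix F lam l - v l) =
  wavg lam (fun i => \sum_(l < n) y l * (F i l - v l)).
Proof.
move=> lamS; rewrite /wavg; under [RHS]eq_bigr do rewrite mulr_sumr.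
rewrite exchange_big /=; apply: eq_bigr => l _.
rewrite -[X in _ - X](wavg_cst _ lamS) /mix /wavg -sumrB mulr_sumr.
by apply: eq_bigr => i _; ring.
Qed.

(** Holds for every realization of the noise, with all the randomness in [u].
    Only [expR u] is bounded: [expR u] enters Markov's inequality, and
    [1 + u <= expR u] the bound in expectation. *)
Lemma greedy_exp_bound (R : realType) (X : Type) (n M k : nat) (x : 'I_n -> X)
    (f : 'I_M -> X -> R) (eta : X -> R) (sigma nu beta : R)
    (prior : 'rV[R]_M) (noise : 'I_n -> R) (lam : nat -> 'rV[R]_M) (j : 'I_M)
    (F := fun j i => f j (x i)) :
  (0 < n)%N -> (2 <= k)%N -> 0 < nu < 1 -> simplex R M prior -> 0 < sigma ->
  0 < beta -> ((2 * sigma ^+ 2)%:E * beta_factor nu k <= beta%:E)%E ->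
  greedy_descent (objective x f nu beta prior (responses x eta noise)) k lam ->
  0 < prior 0 j ->
  exists2 u, MSE x eta (aggregate f (lam k)) <=
      MSE x eta (f j) + beta / n%:R * - ln (prior 0 j) + beta / n%:R * u
    & expR u <= exp_weight F sigma beta prior noise j.
Proof.
move=> n0 k2 nu01 priorS s0 b0 betaE run pj.
have nr0 : 0 < n%:R :> R by rewrite ltr0n.
have k1k : (1 <= k <= k)%N by rewrite leqnn (ltnW k2).
have bn0 : 0 < beta / n%:R by rewrite divr_gt0.
have nu1 : nu <= 1 by case/andP: nu01 => _ /ltW.
have lamS := (run.2 _ k1k).1.
have [domlam rate] := greedy_rate bn0 nu1 priorS run k1k.
set L := lam k in lamS domlam rate *.
set y := tnth (responses x eta noise) in rate.
have yE : y = fun l => eta (x l) + noise l.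
  by apply/funext => l; rewrite /y tnth_mktuple.
pose c := prior_cost (beta / n%:R) prior.
pose B := sqdist y (F j) + c j - (sqdist y (mix F L) + wavg L c).
have oracle theta : 0 < theta <= 1 -> 0 < theta_gap nu k theta ->
    theta_gap nu k theta * spread F L
    + (1 - theta) * (1 - nu) * (1 - 4 / (k + 3)%:R) * sqdist (mix F L) (F j)
    <= B.
  move=> t01 _; rewrite /B lerBrDl addrA; apply: chord_oracle => //=.
  apply: rate.
    apply: simplex_segment => //; last exact: simplex_delta.
    by case/andP: t01 => /ltW ->.
  move=> i pi; rewrite !mxE domlam// eqxx/=.
  rewrite (_ : i == j = false) ?subr0 ?mulr0 ?addr0//.
  by apply/eqP => ij; move: pj; rewrite -ij pi ltxx.
have := beta_factor_bound k2 nu01 s0 (spread_ge0 F lamS) (sqdist_ge0 _ _)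
  betaE oracle.
rewrite -(addrC (sqdist _ _)).
have -> : sqdist (mix F L) (F j) = sqdist (F j) (mix F L).
  by rewrite /sqdist; congr (_ * _); apply: eq_bigr => l _; ring.
rewrite -huygens// => bound.
pose z i := 2 / beta * \sum_(l < n) noise l * (F i l - F j l)
    - 2 * sigma ^+ 2 * n%:R / beta ^+ 2 * sqdist (F j) (F i).
exists (wavg L (fun i => z i + ln (prior 0 i))); last exact: donsker_varadhan.
have uE : beta / n%:R * wavg L (fun i => z i + ln (prior 0 i)) =
    2 / n%:R * \sum_(l < n) noise l * (mix F L l - F j l)
    - 2 * sigma ^+ 2 / beta * wavg L (fun i => sqdist (F j) (F i)) - wavg L c.
  rewrite (sum_mix _ _ _ lamS) -[wavg L c]mul1r -!mulNr -!wavgZ -!wavgD.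
  congr (wavg L _); apply/funext => i; rewrite /z /c /prior_cost.
  by field; rewrite !gt_eqF.
rewrite uE.
have -> : MSE x eta (aggregate f L) = sqdist (eta \o x) (mix F L) by [].
have -> : MSE x eta (f j) = sqdist (eta \o x) (F j) by [].
have := sqdist_noise (eta \o x) noise (F j) (mix F L).
rewrite -[X in sqdist X _](yE) -[X in _ - sqdist X _](yE) => noiseE.
move: bound; rewrite -ler_pdivrMl// /B -/(c j).
set S := wavg L (fun i => sqdist _ _).
have -> : beta^-1 * (2 * sigma ^+ 2 * S) = 2 * sigma ^+ 2 / beta * S by ring.
have -> : beta / n%:R * - ln (prior 0 j) = c j by [].
by move: noiseE; lra.
Qed.

(** * Deviation and expectation of the error *)

Lemma measurable_exp_weight (d : measure_display) (T : measurableType d)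
    (R : realType) (P : probability T R) (n M : nat) (F : 'I_M -> 'I_n -> R)
    (sigma beta : R) (prior : 'rV[R]_M) (xi : 'I_n -> {RV P >-> R})
    (j : 'I_M) :
  measurable_fun setT
    (fun w => exp_weight F sigma beta prior (fun i => xi i w) j).
Proof.
apply: measurable_sum => i; apply: measurable_funM => //.
apply: measurableT_comp; first exact: measurable_expR.
apply: measurable_funB => //; apply: measurable_funM => //.
by apply: measurable_sum => l; exact: measurable_funM.
Qed.

Lemma exp_weight_ge0 (R : realType) (n M : nat) (F : 'I_M -> 'I_n -> R)
    (sigma beta : R) (prior : 'rV[R]_M) (noise : 'I_n -> R) (j : 'I_M) :
  simplex R M prior -> 0 <= exp_weight F sigma beta prior noise j.
Proof.
by move=> [p0 _]; apply: sumr_ge0 => i _; rewrite mulr_ge0 ?expR_ge0.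
Qed.

Lemma integral_exp_weight_le1 (d : measure_display) (T : measurableType d)
    (R : realType) (P : probability T R) (n M : nat) (F : 'I_M -> 'I_n -> R)
    (sigma beta : R) (prior : 'rV[R]_M) (xi : 'I_n -> {RV P >-> R})
    (j : 'I_M) :
  (0 < n)%N -> 0 < beta -> simplex R M prior ->
  sub_gaussian P (fun i => xi i : T -> R) (sigma ^+ 2) ->
  (\int[P]_w (exp_weight F sigma beta prior (fun i => xi i w) j)%:E <= 1)%E.
Proof.
move=> n0 b0 priorS subg; have [p0 p1] := priorS.
have nr0 : 0 < n%:R :> R by rewrite ltr0n.
pose b i := 2 * sigma ^+ 2 * n%:R / beta ^+ 2 * sqdist (F j) (F i).
pose t i := \row_(l < n) (2 / beta * (F i l - F j l)) : 'rV[R]_n.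
pose mgf i w := expR (\sum_(l < n) t i 0 l * xi l w).
have mmgf i : measurable_fun setT (mgf i).
  apply: measurableT_comp; first exact: measurable_expR.
  by apply: measurable_sum => l; exact: measurable_funM.
under eq_integral => w _.
  rewrite (_ : exp_weight _ _ _ _ _ _ =
      \sum_(i < M) (prior 0 i * expR (- b i)) * mgf i w); last first.
    apply: eq_bigr => i _; rewrite -[RHS]mulrA /mgf -expRD -/(b i).
    congr (_ * expR _).
    rewrite addrC mulr_sumr; congr (_ + _); apply: eq_bigr => l _.
    by rewrite mxE; ring.
  rewrite -sumEFin.
  over.
rewrite ge0_integral_sum//; last 2 first.
- by move=> i; apply/measurable_EFinP; exact: measurable_funM.
- by move=> i w _; rewrite lee_fin !mulr_ge0 ?expR_ge0.
rewrite -p1 -sumEFin; apply: lee_sum => i _.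
under eq_integral do rewrite EFinM.
rewrite ge0_integralZl//; last 3 first.
- exact/measurable_EFinP.
- by move=> w _; rewrite lee_fin expR_ge0.
- by rewrite lee_fin mulr_ge0 ?expR_ge0.
rewrite EFinM -muleA -[leRHS]mule1.
apply: lee_wpmul2l; first by rewrite lee_fin.
have := subg (t i); rewrite unlock => mgf_le.
apply: le_trans (lee_wpmul2l _ mgf_le) _; first by rewrite lee_fin expR_ge0.
rewrite -EFinM lee_fin -expRD -[leRHS]expR0 ler_expR le_eqVlt; apply/orP; left.
apply/eqP.
have -> : \sum_(l < n) t i 0 l ^+ 2 =
    (2 / beta) ^+ 2 * \sum_(l < n) (F j l - F i l) ^+ 2.
  by rewrite mulr_sumr; apply: eq_bigr => l _; rewrite mxE; ring.
rewrite /b /sqdist.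
by field; rewrite !gt_eqF.
Qed.

Lemma beta_gt0 (R : realType) (nu sigma beta : R) (k : nat) :
  0 < nu < 1 -> 0 < sigma ->
  ((2 * sigma ^+ 2)%:E * beta_factor nu k <= beta%:E)%E -> 0 < beta.
Proof.
move=> /andP[nu0 nu1] s0 betaE.
have s20 : 0 < 2 * sigma ^+ 2 by rewrite mulr_gt0// exprn_gt0.
have nu01 : 0 < nu <= 1 by rewrite nu0 ltW.
rewrite -lte_fin; apply: lt_le_trans betaE.
apply: lt_le_trans (lee_wpmul2l _ (beta_factor_ge k nu01)).
  by rewrite -EFinM lte_fin mulr_gt0// invr_gt0.
by rewrite lee_fin ltW.
Qed.

Lemma measurable_MSE_aggregate (d : measure_display) (T : measurableType d)
    (R : realType) (X : Type) (n M : nat) (x : 'I_n -> X)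
    (f : 'I_M -> X -> R) (eta : X -> R) (lam : T -> 'rV[R]_M) :
  (forall j, measurable_fun setT (fun w => lam w 0 j)) ->
  measurable_fun setT (fun w => MSE x eta (aggregate f (lam w))).
Proof.
move=> mlam; apply: measurable_funM => //; apply: measurable_sum => i.
apply: measurable_funX; apply: measurable_funB => //.
by apply: measurable_sum => j; exact: measurable_funM.
Qed.

Lemma measurable_responses (d : measure_display) (T : measurableType d)
    (R : realType) (P : probability T R) (X : Type) (n : nat) (x : 'I_n -> X)
    (eta : X -> R) (xi : 'I_n -> {RV P >-> R}) :
  measurable_fun setT (fun w => responses x eta (fun i => xi i w)).
Proof.
apply/measurable_fun_tnthP => i.
rewrite (_ : _ \o _ = fun w => eta (x i) + xi i w); last first.
  by apply/funext => w /=; rewrite tnth_mktuple.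
exact: measurable_funD.
Qed.

Theorem theorem4p2 (R : realType) (d : measure_display) (T : measurableType d)
    (P : probability T R) (X : Type) (n M k : nat)
    (x : 'I_n -> X) (f : 'I_M -> X -> R) (eta : X -> R)
    (xi : 'I_n -> {RV P >-> R}) (sigma nu beta : R) (prior : 'rV[R]_M)
    (J : nat -> n.-tuple R -> 'I_M) (lam : nat -> n.-tuple R -> 'rV[R]_M)
    (Y := fun w : T => responses x eta (fun i => xi i w))
    (Q := fun y : n.-tuple R => objective x f nu beta prior y) :
  (0 < n)%N -> (2 <= k)%N ->
  0 < nu < 1 ->
  simplex R M prior ->
  0 < sigma ->
  independent_RVs xi ->
  (forall i, sub_gaussian P (fun _ : 'I_1 => xi i) (sigma ^+ 2)) ->
  ((2 * sigma ^+ 2)%:E * beta_factor nu k <= beta%:E)%E ->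
  measurable_choices k J lam ->
  (forall y, GMA0 (Q y) k (J ^~ y) (lam ^~ y)) \/
  (forall y, GMA0plus (Q y) k (J ^~ y) (lam ^~ y)) ->
  (forall delta : R, 0 < delta < 1 ->
     ((1 - delta)%:E <=
      P [set w | (MSE x eta (aggregate f (lam k (Y w))))%:E <=
           \big[Order.min/+oo]_(j < M)
             ((MSE x eta (f j))%:E +
              (beta / n%:R)%:E * log_inv (prior 0 j * delta)%R)])%E) /\
  ('E_P[fun w => MSE x eta (aggregate f (lam k (Y w)))] <=
   \big[Order.min/+oo]_(j < M)
     ((MSE x eta (f j))%:E + (beta / n%:R)%:E * log_inv (prior 0 j)%R))%E.
Proof.
move=> n0 k2 nu01 priorS s0 indep subg1 betaE mchoices run.
have nr0 : 0 < n%:R :> R by rewrite ltr0n.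
have b0 : 0 < beta := beta_gt0 nu01 s0 betaE.
have bn0 : 0 < beta / n%:R by rewrite divr_gt0.
have subg := independent_sub_gaussian indep subg1.
have p0 := priorS.1.
have descent y : greedy_descent (Q y) k (lam ^~ y).
  case: run => run; first exact: GMA0_descent (run y).
  exact: GMA0plus_descent (run y).
pose err w := MSE x eta (aggregate f (lam k (Y w))).
pose W j w := exp_weight (fun j i => f j (x i)) sigma beta prior
  (fun i => xi i w) j.
have err0 w : 0 <= err w by exact: sqdist_ge0.
have W0 j w : 0 <= W j w by exact: exp_weight_ge0.
have mW j : measurable_fun setT (W j) by exact: measurable_exp_weight.
have intW j : (\int[P]_w (W j w)%:E <= 1)%E by exact: integral_exp_weight_le1.
have merr : measurable_fun setT err.
  apply: measurable_MSE_aggregate => j.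
  apply: (measurableT_comp (f := fun y => lam k y 0 j)).
    by have [] := mchoices k _ j => //; rewrite leqnn (ltnW k2).
  exact: measurable_responses.
have noise_bound j w : 0 < prior 0 j -> exists2 u,
    err w <= MSE x eta (f j) + beta / n%:R * - ln (prior 0 j) + beta / n%:R * u
    & expR u <= W j w.
  move=> pj.
  exact: (greedy_exp_bound n0 k2 nu01 priorS s0 b0 betaE (descent _) pj).
split=> [delta /andP[d0 d1]|]; last first.
  apply/bigmin_geP; split=> [|j _]; first exact: leey.
  have := p0 j; rewrite le_eqVlt => /orP[/eqP pj|pj].
    by rewrite -pj log_inv0 gt0_muley ?lte_fin// addey// leey.
  rewrite log_inv_gt0// -EFinM -EFinD; set C := (_ + _)%R.
  (* Adding [beta / n] to both sides turns [u <= W - 1] into a comparison of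
     nonnegative functions. *)
  have bound w : err w + beta / n%:R <= C + beta / n%:R * W j w.
    have [u errle uW] := noise_bound j w pj.
    apply: (@le_trans _ _ (C + beta / n%:R * (1 + u))).
      by rewrite /C; lra.
    by rewrite lerD2l ler_pM2l// (le_trans _ uW)// expR_ge1Dx.
  have C0 : 0 <= C.
    apply: addr_ge0; first exact: sqdist_ge0.
    by rewrite mulr_ge0 ?(ltW bn0)// oppr_ge0 ln_le0// simplex_le1.
  have mEerr : measurable_fun setT (EFin \o err) by exact/measurable_EFinP.
  have mEW : measurable_fun setT (EFin \o W j) by exact/measurable_EFinP.
  have int_cst (r : R) : (\int[P]_w r%:E = r%:E)%E.
    by have := expectation_cst P r; rewrite unlock.
  have lhs : (\int[P]_w (err w + beta / n%:R)%:E =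
      \int[P]_w (err w)%:E + (beta / n%:R)%:E)%E.
    under eq_integral do rewrite EFinD.
    rewrite ge0_integralD ?int_cst//; first by move=> w _; rewrite lee_fin.
    by move=> w _; rewrite lee_fin ltW.
  have rhs : (\int[P]_w (C + beta / n%:R * W j w)%:E <=
      C%:E + (beta / n%:R)%:E)%E.
    under eq_integral do rewrite EFinD EFinM.
    rewrite ge0_integralD//; last 2 first.
    - by move=> w _; rewrite -EFinM lee_fin mulr_ge0// ltW.
    - exact: measurable_funeM.
    rewrite int_cst leeD2l// ge0_integralZl//; last 2 first.
    - by move=> w _; rewrite lee_fin.
    - by rewrite lee_fin ltW.
    by rewrite -[leRHS]mule1 lee_wpmul2l// lee_fin ltW.
  rewrite unlock -(@leeD2rE _ (beta / n%:R)%:E)// -lhs; apply: le_trans rhs.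
  apply: ge0_le_integral => //.
  - by move=> w _; rewrite lee_fin addr_ge0// ltW.
  - by apply/measurable_EFinP; exact: measurable_funD.
  - apply/measurable_EFinP; apply: measurable_funD => //.
    exact: measurable_funM.
  - by move=> w _; rewrite lee_fin.
have [j0 pj0] := simplex_support priorS.
pose oracle j := ((MSE x eta (f j))%:E +
  (beta / n%:R)%:E * log_inv (prior 0 j * delta)%R)%E.
(* The minimum is attained at an index that does not depend on the data. *)
have [j _ ->] := eq_bigmin (x := +oo%E) j0 xpredT oracle isT
  (fun i _ => leey _).
set S := [set w | _]; pose bad := ~` S.
have mS : measurable S.
  rewrite -[S]setTI; apply: measurable_lee => //; exact/measurable_EFinP.
have mbad : measurable bad by exact: measurableC.
have large w : bad w -> 1 <= delta * W j w.
  move=> /negP; rewrite -ltNge /oracle.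
  have := p0 j; rewrite le_eqVlt => /orP[/eqP pj|pj].
    by rewrite -pj mul0r log_inv0 gt0_muley ?lte_fin// addey// ltNge leey.
  rewrite log_inv_gt0 ?mulr_gt0// -EFinM -EFinD lte_fin lnM ?posrE//.
  rewrite opprD mulrDr addrA.
  have [u errle uW] := noise_bound j w pj; move=> /lt_le_trans/(_ errle).
  rewrite ltrD2l ltr_pM2l// ltrNl => lnd.
  have : 1 <= delta * expR u.
    rewrite -[delta in leRHS]lnK ?posrE// -expRD -[leLHS]expR0 ler_expR.
    lra.
  by move=> /le_trans; apply; rewrite ler_wpM2l// ltW.
have Pbad : (P bad <= delta%:E)%E.
  have -> : P bad = (\int[P]_w (\1_bad w)%:E)%E.
    by rewrite integral_indic// setIT.
  apply: (@le_trans _ _ (\int[P]_w (delta * W j w)%:E)%E).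
    apply: ge0_le_integral => //.
    - exact/measurable_EFinP/measurable_indic.
    - by apply/measurable_EFinP; exact: measurable_funM.
    - move=> w _; rewrite lee_fin indicE.
      have [/set_mem bw|_] := boolP (w \in bad); first exact: large.
      by rewrite mulr_ge0// ltW.
  under eq_integral do rewrite EFinM.
  rewrite ge0_integralZl//; last 3 first.
  - exact/measurable_EFinP.
  - by move=> w _; rewrite lee_fin.
  - by rewrite lee_fin ltW.
  by rewrite -[leRHS]mule1 lee_wpmul2l// lee_fin ltW.
have -> : P S = (1 - P bad)%E by rewrite -probability_setC// setCK.
by rewrite EFinB leeB.
Qed.
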